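(* Let $S$ be a finite nonempty set, let $1\le k<n$ be integers, and consider the nonhomogeneous $k$-th order multistate Markov parametrization $\phi$ on $S$ for paths of length $n$, together with a specified collection of forbidden transitions. Let $F\subseteq S^n$ be the set of paths $(i_1,\ldots,i_n)$ involving at least one forbidden transition. Then $$\mathcal{V}_F=\mathcal{V}\cap\{\,p\in\mathbb{R}^{S^n}\mid p_{i_1\ldots i_n}=0\ \text{for all}\ (i_1,\ldots,i_n)\in F\,\}.$$
   Context: Points of $\mathbb{R}^{S^k}\times\prod_{\ell=k+1}^n\mathbb{R}^{S^{k+1}}$ are written $(\pi,a)$ with coordinates $\pi_{i_1\ldots i_k}$ and $a^{(\ell)}_{i_{\ell-k}\cdots i_\ell}$ ($\ell=k+1,\dots,n$), all arbitrary real numbers. The map $\phi$ to $\mathbb{R}^{S^n}$ is $$\phi_{i_1\ldots i_n}(\pi,a)=\pi_{i_1\ldots i_k}\prod_{\ell=k+1}^n a^{(\ell)}_{i_{\ell-k}\cdots i_{\ell-1}i_\ell}.$$ A collection of forbidden transitions is a set $T$ of pairs $(\ell,(j_0,\dots,j_k))$ with $\ell\in\{k+1,\dots,n\}$ and $(j_0,\dots,j_k)\in S^{k+1}$; forbidding them means imposing $a^{(\ell)}_{j_0\cdots j_k}=0$ for every $(\ell,(j_0,\dots,j_k))\in T$. A path $(i_1,\dots,i_n)\in S^n$ involves a forbidden transition if $(\ell,(i_{\ell-k},\dots,i_\ell))\in T$ for some $\ell\in\{k+1,\dots,n\}$. $\mathcal{V}=\phi\bigl(\mathbb{R}^{S^k}\times\prod_{\ell=k+1}^n\mathbb{R}^{S^{k+1}}\bigr)$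 is the image of the whole parameter space, and $\mathcal{V}_F$ is the image under $\phi$ of the set of those $(\pi,a)$ whose forbidden transition parameters are all zero (no nonnegativity or sum-to-one constraints are imposed). *)

(* Defs.v *)
From mathcomp Require Import all_boot all_order all_algebra.
From mathcomp Require Import all_classical all_reals.

Set Implicit Arguments.
Unset Strict Implicit.
Unset Printing Implicit Defensive.

Import Order.TTheory GRing.Theory Num.Theory.
Local Open Scope classical_set_scope.
Local Open Scope ring_scope.

(* A path (i_1, ..., i_n) is an [n.-tuple S], hence indexed from 0.  The time
   index l ranging over {k+1, ..., n} is encoded by [t : 'I_(n - k)] with
   l = k + 1 + t; the 0-based positions of i_(l-k), ..., i_l are then
   t, ..., t + k. *)

Lemma window_subproof (n k : nat) (t : 'I_(n - k)) (j : 'I_k.+1) :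
  (t + j < n)%N.
Proof.
have tk : (t + k < n)%N by rewrite addnC -ltn_subRL.
by apply: leq_ltn_trans tk; rewrite leq_add2l -ltnS.
Qed.

Section MarkovParametrization.
Variables (R : realType) (S : finType) (n k : nat).

Definition window (t : 'I_(n - k)) (i : n.-tuple S) : k.+1.-tuple S :=
  [tuple tnth i (Ordinal (window_subproof t j)) | j < k.+1].

Definition initial (kn : (k < n)%N) (i : n.-tuple S) : k.-tuple S :=
  [tuple tnth i (widen_ord (ltnW kn) j) | j < k].

Definition params : Type :=
  {ffun k.-tuple S -> R} * {ffun 'I_(n - k) -> {ffun k.+1.-tuple S -> R}}.

Definition phi (kn : (k < n)%N) (x : params) : {ffun n.-tuple S -> R} :=
  [ffun i => x.1 (initial kn i) * \prod_(t < n - k) x.2 t (window t i)].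

Definition forbidden_paths (T : {set 'I_(n - k) * k.+1.-tuple S}) :
    {set n.-tuple S} :=
  [set i | [exists t, (t, window t i) \in T]]%SET.

Definition model (kn : (k < n)%N) : set {ffun n.-tuple S -> R} :=
  range (phi kn).

Definition restricted_model (kn : (k < n)%N)
    (T : {set 'I_(n - k) * k.+1.-tuple S}) : set {ffun n.-tuple S -> R} :=
  phi kn @` [set x : params | forall t w, (t, w) \in T -> x.2 t w = 0].

End MarkovParametrization.

Arguments model R S {n k} kn.
Arguments restricted_model R {S n k} kn T.

(* Main.v *)
(** If [phi x] vanishes on every path that uses a forbidden transition, then
    overwriting the forbidden parameters of [x] by zero does not change
    [phi x]: the other paths never read these parameters, and along a
    forbidden path both values are zero. *)

Require Import Defs.
From mathcomp Require Import all_boot all_order all_algebra.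
From mathcomp Require Import all_classical all_reals.

Set Implicit Arguments.
Unset Strict Implicit.
Unset Printing Implicit Defensive.

Import GRing.Theory.

Local Open Scope classical_set_scope.
Local Open Scope ring_scope.

Section ZeroForbidden.
Variables (R : realType) (S : finType) (n k : nat) (kn : (k < n)%N).
Variable T : {set 'I_(n - k) * k.+1.-tuple S}.

Definition zero_forbidden (x : params R S n k) : params R S n k :=
  (x.1, [ffun t => [ffun w => if (t, w) \in T then 0 else x.2 t w]]).

(** Each forbidden transition on the path contributes a zero factor to the monomial [phi kn x i]. *)
Lemma phi_forbidden_eq0 (x : params R S n k) (i : n.-tuple S) :
  (forall t w, (t, w) \in T -> x.2 t w = 0) ->
  i \in forbidden_paths T -> phi kn x i = 0.
Proof.
move=> x0; rewrite inE => /existsP[t /x0 xt0].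
by rewrite ffunE (bigD1 t) //= xt0 mul0r mulr0.
Qed.

Lemma zero_forbidden_eq0 (x : params R S n k) t w :
  (t, w) \in T -> (zero_forbidden x).2 t w = 0.
Proof. by rewrite !ffunE => ->. Qed.

Lemma phi_zero_forbidden (x : params R S n k) (i : n.-tuple S) :
  i \notin forbidden_paths T -> phi kn (zero_forbidden x) i = phi kn x i.
Proof.
rewrite inE => /existsPn iT; rewrite !ffunE; congr (_ * _).
by apply: eq_bigr => t _; rewrite !ffunE (negbTE (iT t)).
Qed.

End ZeroForbidden.

Theorem proposition4p4 (R : realType) (S : finType) (n k : nat)
    (S_gt0 : (0 < #|S|)%N) (k_gt0 : (1 <= k)%N) (kn : (k < n)%N)
    (T : {set 'I_(n - k) * k.+1.-tuple S}) :
  restricted_model R kn T =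
    model R S kn `&`
    [set p : {ffun n.-tuple S -> R} |
      forall i : n.-tuple S, i \in forbidden_paths T -> p i = 0].
Proof.
apply/seteqP; split=> [_ [x x0 <-]|_ [[x _ <-] /= p0]].
  split; first by exists x.
  by move=> i; apply: phi_forbidden_eq0.
(* [x] itself may violate the constraints: a forbidden parameter can be nonzero when other factors
   vanish on every path through it. *)
exists (zero_forbidden T x); first exact: zero_forbidden_eq0.
apply/ffunP => i; have [iF|iF] := boolP (i \in forbidden_paths T).
  (* The right-hand side is zero by [p0], the left-hand side because the witness meets the
     constraints. *)
  by rewrite p0 //; apply: phi_forbidden_eq0 iF => t w; apply: zero_forbidden_eq0.
exact: phi_zero_forbidden.
Qed.
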